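(* Let $H$ be a real Hilbert space and let $K\subseteq H$ be a closed convex cone. Then the distance function $d(\cdot,K):H\to[0,\infty)$ is sublinear.
   Context: $H$ is a real Hilbert space with norm $\lVert\cdot\rVert$. A closed convex cone is a nonempty closed set $K\subseteq H$ such that $\lambda x+\mu y\in K$ for all $x,y\in K$ and all real $\lambda,\mu\ge 0$. $d(x,K)=\min_{y\in K}\lVert x-y\rVert$ is the distance from $x$ to $K$. A function $q:H\to\mathbb{R}$ is sublinear if $q(\lambda x)=\lambda q(x)$ and $q(x+y)\le q(x)+q(y)$ for all real $\lambda\ge 0$ and all $x,y\in H$. *)

(* Defs.v *)
From mathcomp Require Import all_boot all_order all_algebra.
From mathcomp Require Import all_classical all_reals all_analysis.
Import Order.TTheory GRing.Theory Num.Theory.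
Import numFieldNormedType.Exports.

Set Implicit Arguments.
Unset Strict Implicit.
Unset Printing Implicit Defensive.

Local Open Scope classical_set_scope.
Local Open Scope ring_scope.

(* A real Hilbert space is a complete normed module [H] whose norm (and hence
   topology) comes from a positive definite symmetric bilinear form. *)
Definition norm_induced_by (R : realType) (H : completeNormedModType R)
    (dot : {dot H for (@idfun R)}) : Prop :=
  forall x : H, `|x| ^+ 2 = dot x x.

Definition closed_convex_cone (R : realType) (H : completeNormedModType R)
    (K : set H) : Prop :=
  [/\ K !=set0, closed K &
      forall (x y : H) (l m : R),
        K x -> K y -> 0 <= l -> 0 <= m -> K (l *: x + m *: y)].

Definition minimums (R : realType) (A : set R) : set R := A `&` lbound A.

(* Meaningful only when the minimum is attained: the default value is 0. *)
Definition dist (R : realType) (H : completeNormedModType R)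
    (x : H) (K : set H) : R :=
  xget 0 (minimums [set `|x - y| | y in K]).

Definition sublinear (R : realType) (H : completeNormedModType R)
    (q : H -> R) : Prop :=
  (forall (l : R) (x : H), 0 <= l -> q (l *: x) = l * q x) /\
  (forall x y : H, q (x + y) <= q x + q y).

(* Main.v *)
Require Import Defs.
From mathcomp Require Import all_boot all_order all_algebra.
From mathcomp Require Import all_classical all_reals all_analysis.
From mathcomp Require Import ring lra.
Import Order.TTheory GRing.Theory Num.Theory.
Import numFieldNormedType.Exports.
Local Open Scope classical_set_scope.
Local Open Scope ring_scope.

(** The only real issue is that the distance to a closed convex set is attained
    in a Hilbert space. Points of [K] whose distance to [x] is nearly the
    infimum [d] must be close to each other: their midpoint lies in [K], hence
    is at distance at least [d] from [x], and the parallelogram identity then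
    bounds the distance between them ([near_minimizers_close]). The sets of
    near minimizers therefore generate a Cauchy filter, whose limit is a nearest
    point ([nearest_point_exists]).

    Sublinearity follows by moving nearest points around inside the cone: if
    [p] and [q] are nearest to [x] and [y], then [l *: p] and [p + q] belong to
    [K] and compete in the minima for [l *: x] and [x + y]. For homogeneity this
    gives only an upper bound for the distance from [l *: x]; when [0 < l] the
    reverse bound is the same inequality applied to [l^-1] and [l *: x]. *)

Lemma parallelogram (R : realType) (H : completeNormedModType R)
    (dot : {dot H for (@idfun R)}) (x y : H) :
  norm_induced_by dot ->
  `|x + y| ^+ 2 + `|x - y| ^+ 2 = 2 * `|x| ^+ 2 + 2 * `|y| ^+ 2.
Proof.
move=> normE; rewrite !normE (hnormD dot) (hnormB dot) /=.
ring.
Qed.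

(** Quantitative form of the strict convexity of the squared norm: apply the
    parallelogram identity to [x - y] and [x - z], whose sum is twice the vector
    from the midpoint to [x]. The bound is [4 * (d + e) ^+ 2 - 4 * d ^+ 2]. *)
Lemma near_minimizers_close (R : realType) (H : completeNormedModType R)
    (dot : {dot H for (@idfun R)}) (x y z : H) (d e : R) :
  norm_induced_by dot -> 0 <= d -> 0 <= e ->
  d <= `|x - (2^-1 *: y + 2^-1 *: z)| ->
  `|x - y| <= d + e -> `|x - z| <= d + e ->
  `|y - z| ^+ 2 <= 4 * e * (2 * d + e).
Proof.
move=> normE d0 e0 dmid xy xz.
have := parallelogram R H dot (x - y) (x - z) normE.
have -> : x - y + (x - z) = 2 *: (x - (2^-1 *: y + 2^-1 *: z)).
  rewrite scalerBr scalerDr !scalerA mulfV ?pnatr_eq0// !scale1r.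
  by rewrite scaler_nat mulr2n opprD addrACA.
have -> : x - y - (x - z) = - (y - z) by rewrite !opprB addrC addrA subrK.
rewrite normrN normrZ ger0_norm//.
have := normr_ge0 (x - y); have := normr_ge0 (x - z).
set m := `|x - (_ + _)| in dmid *; set a := `|x - y| in xy *.
set b := `|x - z| in xz *; set c := `|y - z|; move=> b0 a0 par.
have m2 : d ^+ 2 <= m ^+ 2 by rewrite lerXn2r ?nnegrE// (le_trans d0).
have a2 : a ^+ 2 <= (d + e) ^+ 2 by rewrite lerXn2r ?nnegrE ?addr_ge0.
have b2 : b ^+ 2 <= (d + e) ^+ 2 by rewrite lerXn2r ?nnegrE ?addr_ge0.
nra.
Qed.

(** Stability under midpoints is the form of convexity that the parallelogram
    identity calls for. *)
Lemma nearest_point_exists (R : realType) (H : completeNormedModType R)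
    (dot : {dot H for (@idfun R)}) (K : set H) (x : H) :
  norm_induced_by dot -> K !=set0 -> closed K ->
  (forall y z, K y -> K z -> K (2^-1 *: y + 2^-1 *: z)) ->
  exists2 p, K p & forall y, K y -> `|x - p| <= `|x - y|.
Proof.
move=> normE [k0 Kk0] clK midK.
pose A := [set `|x - y| | y in K]; pose d := inf A.
have lbA0 : lbound A 0 by move=> _ [y _ <-].
have hasA : has_inf A.
  by split; [exists `|x - k0|; exists k0 | exists 0].
have dle y : K y -> d <= `|x - y|.
  by move=> Ky; apply: ge_inf; [exists 0 | exists y].
have d0 : 0 <= d by apply: lb_le_inf => //; case: hasA.
pose near_min e := K `&` [set y | `|x - y| <= d + e].
(* A filter rather than a minimizing sequence, which avoids choosing points. *)
pose F := filter_from [set e : R | 0 < e] near_min.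
have near_min0 e : 0 < e -> near_min e !=set0.
  move=> e0; have [_ [y Ky <-] ylt] := inf_adherent e0 hasA.
  by exists y; split => //=; exact: ltW.
have FF : ProperFilter F.
  apply: filter_from_proper; last exact: near_min0.
  apply: filter_from_filter; first by exists 1 => /=.
  move=> i j i0 j0; exists (Num.min i j); first by rewrite /= lt_min i0.
  move=> y [Ky /= yle].
  by split; split => //=; apply: le_trans yle _; rewrite lerD2l ge_min lexx ?orbT.
have cauchyF : cauchy F.
  apply: cauchy_exP => eps eps0.
  (* Chosen so that e < 1 and 4 * e * (2 * d + 1) < eps ^+ 2. *)
  pose e := eps ^+ 2 / (4 * (2 * d + 1 + eps ^+ 2)).
  have eps20 : 0 < eps ^+ 2 by rewrite exprn_gt0.
  have D0 : 0 < 4 * (2 * d + 1 + eps ^+ 2) by nra.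
  have e0 : 0 < e by rewrite divr_gt0.
  have eD : e * (4 * (2 * d + 1 + eps ^+ 2)) = eps ^+ 2 by rewrite divfK ?gt_eqF.
  have [y [Ky ydist]] := near_min0 e e0.
  exists y, e => // z [Kz zdist].
  rewrite -ball_normE /= -(@ltr_pXn2r _ 2)// ?nnegrE ?(ltW eps0)//.
  apply: le_lt_trans (near_minimizers_close _ _ dot x y z d e normE d0 (ltW e0)
    (dle _ (midK _ _ Ky Kz)) ydist zdist) _.
  nra.
have /cauchy_cvg cvF := cauchyF.
pose p := lim F.
have Fp : F --> p := cvF.
exists p.
  apply: clK => B Bp.
  have FK : F K by exists 1 => //= y [].
  exact: filter_ex (filterI FK (Fp _ Bp)).
move=> y Ky; apply: le_trans (dle y Ky).
apply/ler_addgt0Pr => e e0.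
have e20 : 0 < e / 2 by rewrite divr_gt0.
have Fe : F (near_min (e / 2)) by exists (e / 2).
have [z [[_ /= zd] pz]] := filter_ex (filterI Fe (Fp _ (nbhsx_ballx p _ e20))).
move: pz; rewrite -ball_normE /= distrC => /ltW pz.
have := ler_distD z x p; lra.
Qed.

Theorem corollary4p1 (R : realType) (H : completeNormedModType R)
    (dot : {dot H for (@idfun R)}) (H_hilbert : norm_induced_by dot)
    (K : set H) (K_cone : closed_convex_cone K) :
  [/\ forall x : H, minimums [set `|x - y| | y in K] (dist x K),
      forall x : H, 0 <= dist x K &
      sublinear (fun x : H => dist x K)].
Proof.
have [K0 clK coneK] := K_cone.
have half0 : 0 <= 2^-1 :> R by rewrite invr_ge0.
have distP x : minimums [set `|x - y| | y in K] (dist x K).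
  have [|p Kp pmin] := nearest_point_exists _ _ dot K x H_hilbert K0 clK.
    by move=> y z Ky Kz; exact: coneK.
  apply: (xgetI 0); split; first by exists p.
  by move=> _ [y Ky <-]; exact: pmin.
have dist_le x y : K y -> dist x K <= `|x - y|.
  by move=> Ky; apply: (distP x).2; exists y.
have dist_attained x : exists2 p, K p & `|x - p| = dist x K.
  by have [[p Kp pE] _] := distP x; exists p.
have dist_ge0 x : 0 <= dist x K by have [p _ <-] := dist_attained x.
have distZ_le l x : 0 <= l -> dist (l *: x) K <= l * dist x K.
  move=> l0; have [p Kp <-] := dist_attained x.
  have Klp : K (l *: p).
    by have := coneK p p l 0 Kp Kp l0 (lexx 0); rewrite scale0r addr0.
  by apply: le_trans (dist_le _ _ Klp) _; rewrite -scalerBr normrZ ger0_norm.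
split=> //; split=> [l x l0|x y].
- apply/eqP; rewrite eq_le distZ_le//=.
  have [->|l_neq0] := eqVneq l 0; first by rewrite mul0r dist_ge0.
  have {}l0 : 0 < l by rewrite lt0r l_neq0.
  rewrite mulrC -ler_pdivlMr// [leRHS]mulrC.
  rewrite -[X in dist X K <= _](scalerK l_neq0).
  by apply: distZ_le; rewrite invr_ge0 ltW.
- have [p Kp <-] := dist_attained x; have [q Kq <-] := dist_attained y.
  have Kpq : K (p + q).
    by have := coneK p q 1 1 Kp Kq ler01 ler01; rewrite !scale1r.
  by apply: le_trans (dist_le _ _ Kpq) _; rewrite opprD addrACA ler_normD.
Qed.
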